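(* Let $a(n) = [x^{n}]\,\bigl((1-x)(1-x^{2})\bigr)^{-n}$ for $n\ge 0$ and let $A = A(t) = \sum_{n\ge 0} a(n)\,t^{n} \in \mathbb{Q}[[t]]$ be its ordinary generating function. Then $P(t, A(t)) = 0$ in $\mathbb{Q}[[t]]$, where $$P(t, A) \;=\; (256 t^{2} + 107 t - 32)\,(A^{4} - A^{3}) + (96 t^{2} + 36 t)\,A^{2} - (16 t^{2} + 4 t)\,A + t^{2}.$$
   Context: $[x^{n}]\,g(x)$ denotes the coefficient of $x^{n}$ in the formal power series $g(x)$. The sequence $a(n)$ is OEIS A348410, with first values $1, 1, 5, 19, 85, 376, 1715, 7890, \ldots$ for $n=0,1,2,\ldots$ *)

(* Defs.v *)
From HB Require Import structures.
From mathcomp Require Import all_boot all_order all_algebra.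
From mathcomp Require Import boolp.

Set Implicit Arguments.
Unset Strict Implicit.
Unset Printing Implicit Defensive.

Import GRing.Theory.
Local Open Scope ring_scope.

(* The ring R[[x]] of formal power series. A record rather than a bare function
   type, so that [*] is the Cauchy product and not the pointwise product that
   MathComp-Analysis puts on functions. Equality is decided classically, as the
   MathComp ring structures need. *)
Record fps (R : Type) := Fps { fcoef : nat -> R }.

HB.instance Definition _ (R : Type) := gen_eqMixin (fps R).
HB.instance Definition _ (R : Type) := gen_choiceMixin (fps R).

Lemma fpsP (R : Type) (f g : fps R) :
  (forall n, fcoef f n = fcoef g n) -> f = g.
Proof. by case: f g => [f] [g] /= fg; congr Fps; apply/funext. Qed.

Section FpsZmodule.
Variable R : zmodType.
Implicit Types f g h : fps R.

Definition fps_zero : fps R := Fps (fun=> 0).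
Definition fps_opp f : fps R := Fps (fun n => - fcoef f n).
Definition fps_add f g : fps R := Fps (fun n => fcoef f n + fcoef g n).

Fact fps_addA : associative fps_add.
Proof. by move=> f g h; apply: fpsP => n /=; rewrite addrA. Qed.

Fact fps_addC : commutative fps_add.
Proof. by move=> f g; apply: fpsP => n /=; rewrite addrC. Qed.

Fact fps_add0 : left_id fps_zero fps_add.
Proof. by move=> f; apply: fpsP => n /=; rewrite add0r. Qed.

Fact fps_addN : left_inverse fps_zero fps_opp fps_add.
Proof. by move=> f; apply: fpsP => n /=; rewrite addNr. Qed.

HB.instance Definition _ :=
  GRing.isZmodule.Build (fps R) fps_addA fps_addC fps_add0 fps_addN.

End FpsZmodule.

Section FpsRing.
Variable R : comNzRingType.
Implicit Types f g h : fps R.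

Definition fps_one : fps R := Fps (fun n => (n == 0%N)%:R).
Definition fps_mul f g : fps R :=
  Fps (fun n => \sum_(i < n.+1) fcoef f i * fcoef g (n - i)%N).

Definition fps_trunc n f : {poly R} := \poly_(i < n.+1) fcoef f i.

Fact coef_fps_trunc n f i : (i <= n)%N -> (fps_trunc n f)`_i = fcoef f i.
Proof. by move=> le_in; rewrite coef_poly ltnS le_in. Qed.

Fact fps_mul_trunc n f g i : (i <= n)%N ->
  fcoef (fps_mul f g) i = (fps_trunc n f * fps_trunc n g)`_i.
Proof.
move=> le_in; rewrite coefM /=; apply: eq_bigr => j _.
rewrite !coef_fps_trunc //; first exact: leq_trans (leq_subr _ _) le_in.
by apply: leq_trans le_in; rewrite -ltnS.
Qed.

Fact fps_mulC : commutative fps_mul.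
Proof.
by move=> f g; apply: fpsP => n; rewrite !(fps_mul_trunc _ _ (leqnn n)) mulrC.
Qed.

Fact fps_mulA : associative fps_mul.
Proof.
move=> f g h; apply: fpsP => n.
transitivity (fps_trunc n f * (fps_trunc n g * fps_trunc n h))`_n.
  rewrite coefM [LHS]/=; apply: eq_bigr => j _.
  by rewrite coef_fps_trunc -1?ltnS // -fps_mul_trunc ?leq_subr.
rewrite mulrA coefM [RHS]/=; apply: eq_bigr => j _.
by rewrite -fps_mul_trunc -1?ltnS // coef_fps_trunc ?leq_subr.
Qed.

Fact fps_mul1 : left_id fps_one fps_mul.
Proof.
move=> f; apply: fpsP => n /=.
rewrite big_ord_recl /= mul1r subn0 big1 ?addr0 // => i _.
by rewrite mul0r.
Qed.

Fact fps_mulDl : left_distributive fps_mul (@fps_add R).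
Proof.
move=> f g h; apply: fpsP => n /=; rewrite -big_split /=.
by apply: eq_bigr => i _; rewrite mulrDl.
Qed.

Fact fps_oner_neq0 : fps_one != 0.
Proof.
by apply/eqP => /(congr1 (fun f => fcoef f 0%N)) /= /eqP; rewrite oner_eq0.
Qed.

HB.instance Definition _ := GRing.Zmodule_isComNzRing.Build (fps R)
  fps_mulA fps_mulC fps_mul1 fps_mulDl fps_oner_neq0.

Definition fpsX : fps R := Fps (fun n => (n == 1%N)%:R).

End FpsRing.

Section FpsUnitRing.
Variable R : comUnitRingType.
Implicit Types f g : fps R.

Definition fps_unit : pred (fps R) := fun f => fcoef f 0%N \is a GRing.unit.

(* The first n coefficients of the inverse g of f, obtained by solving
   \sum_(i <= n) g_i * f_(n - i) = (n == 0)%:R for g_n. *)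
Fixpoint fps_inv_seq f n : seq R :=
  if n is m.+1 then
    let s := fps_inv_seq f m in
    rcons s ((fcoef f 0%N)^-1 *
             ((m == 0%N)%:R - \sum_(i < m) s`_i * fcoef f (m - i)%N))
  else [::].

(* Non-units are their own inverse by MathComp's convention. *)
Definition fps_inv f : fps R :=
  if fps_unit f then Fps (fun n => (fps_inv_seq f n.+1)`_n) else f.

Fact size_fps_inv_seq f n : size (fps_inv_seq f n) = n.
Proof. by elim: n => //= n IHn; rewrite size_rcons IHn. Qed.

Fact nth_fps_inv_seq f n i : (i < n)%N ->
  (fps_inv_seq f n)`_i = (fps_inv_seq f i.+1)`_i.
Proof.
elim: n => // n IHn; rewrite ltnS leq_eqVlt => /predU1P[-> //|lt_in].
by rewrite -IHn // [fps_inv_seq f n.+1]/= nth_rcons size_fps_inv_seq lt_in.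
Qed.

Fact fps_mulV : {in fps_unit, left_inverse 1 fps_inv *%R}.
Proof.
move=> f Uf; rewrite /fps_inv (_ : fps_unit f = true) //.
apply: fpsP => n; rewrite [LHS]/=.
rewrite (eq_bigr (fun i : 'I_n.+1 =>
  (fps_inv_seq f n.+1)`_i * fcoef f (n - i)%N)); last first.
  by move=> i _; rewrite -/(fps_inv_seq f i.+1) -(nth_fps_inv_seq f (ltn_ord i)).
rewrite big_ord_recr /= subnn nth_rcons size_fps_inv_seq ltnn eqxx mulrAC mulVr // mul1r addrC.
under [X in _ + X]eq_bigr do rewrite nth_rcons size_fps_inv_seq ltn_ord.
exact: subrK.
Qed.

Fact fps_unitPl f g : g * f = 1 -> fps_unit f.
Proof.
move=> /(congr1 (fun h => fcoef h 0%N)) /=; rewrite big_ord1 => gf1.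
by apply/unitrPr; exists (fcoef g 0%N); rewrite mulrC.
Qed.

Fact fps_inv_out : {in [predC fps_unit], fps_inv =1 id}.
Proof. by move=> f nUf; rewrite /fps_inv ifN. Qed.

HB.instance Definition _ := GRing.ComNzRing_hasMulInverse.Build (fps R)
  fps_mulV fps_unitPl fps_inv_out.

End FpsUnitRing.

Definition a348410 (n : nat) : rat :=
  let x := fpsX rat in fcoef (((1 - x) * (1 - x ^+ 2)) ^- n) n.

(* Main.v *)
From HB Require Import structures.
Require Import Defs.
From mathcomp Require Import all_boot all_order all_algebra.
From mathcomp Require Import ring.

(** Write [psi = (1 - x) (1 - x^2)], [u = x psi] and [phi = psi^-1], so that
    [a(n)] is the coefficient of [x^n] in [phi^n].  Lagrange inversion says that
    the series whose [n]-th coefficient is [x^n] of [F u' phi^(n+1)] is [F]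
    rewritten as a power series in [u], that is [F] composed with the
    compositional inverse of [u].  For [F = psi / u'] these coefficients are the
    [a(n)]; hence [A] is [psi / u' = (1 - x^2) / (1 - x - 4 x^2)] written in the
    variable [u], with [u] renamed [t].  The equation [P(t, A) = 0] is therefore
    the image of [P(u, psi / u') = 0], an identity between rational functions of
    [x].

    The proof never composes power series.  The map [T] that sends [F] to
    [sum_n ([x^n] F u' phi^(n+1)) x^n], here [expand_in_u], is shown directly to
    be a ring morphism that sends [u] to [x].  That [T (u F) = x (T F)] is a
    shift of indices ([expand_in_uM]); that [T] fixes [1] is the statement that
    [u' / u^(m+1)] is a derivative for [m > 0], hence has no residue
    ([expand_in_u1]); and these two facts force multiplicativity, one
    coefficient at a time ([expand_in_u_mul]). *)

Import GRing.Theory.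
Local Open Scope ring_scope.

(** * Constants, shifts and the Euler operator on power series *)

Definition fpsC {R : comNzRingType} (c : R) : fps R :=
  Fps (fun n => if n == 0%N then c else 0).

Definition fps_shift {R : comNzRingType} (f : fps R) : fps R :=
  Fps (fun n => fcoef f n.+1).

Lemma fcoef_mulC (R : comNzRingType) (c : R) (f : fps R) n :
  fcoef (fpsC c * f) n = c * fcoef f n.
Proof.
by rewrite /= big_ord_recl /= subn0 big1 ?addr0 // => i _; rewrite mul0r.
Qed.

Lemma fcoef_mulX0 (R : comNzRingType) (f : fps R) : fcoef (fpsX R * f) 0 = 0.
Proof. by rewrite /= big_ord1 mul0r. Qed.

Lemma fcoef_mulXS (R : comNzRingType) (f : fps R) n :
  fcoef (fpsX R * f) n.+1 = fcoef f n.
Proof.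
rewrite /= !big_ord_recl /= mul0r add0r mul1r big1 ?addr0 ?subn1 //.
by move=> i _; rewrite mul0r.
Qed.

Lemma fcoefD (R : zmodType) (f g : fps R) n :
  fcoef (f + g) n = fcoef f n + fcoef g n.
Proof. by []. Qed.

Lemma fcoefN (R : zmodType) (f : fps R) n : fcoef (- f) n = - fcoef f n.
Proof. by []. Qed.

Lemma fcoefM0 (R : comNzRingType) (f g : fps R) :
  fcoef (f * g) 0 = fcoef f 0 * fcoef g 0.
Proof. by rewrite /= big_ord1. Qed.

Lemma natr_fpsC (R : comNzRingType) m : m%:R = fpsC m%:R :> fps R.
Proof.
elim: m => [|m IHm]; first by apply: fpsP => -[].
rewrite mulrSr IHm; apply: fpsP => -[|i]; rewrite fcoefD /= ?addr0 //.
by rewrite [RHS]mulrSr.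
Qed.

Lemma unit_fpsE (R : comUnitRingType) (f : fps R) :
  (f \is a GRing.unit) = (fcoef f 0 \is a GRing.unit).
Proof. by []. Qed.

Lemma fps_shiftK (R : comNzRingType) (f : fps R) :
  fpsC (fcoef f 0) + fpsX R * fps_shift f = f.
Proof.
apply: fpsP => -[|n]; rewrite fcoefD ?fcoef_mulX0 ?addr0 //.
by rewrite fcoef_mulXS add0r.
Qed.

(** The operator [x d/dx].  It is preferred to [d/dx] because it preserves
    degrees: [x u' = euler u], and [u' = psi + euler psi] when [u = x psi]. *)
Definition euler {R : comNzRingType} (f : fps R) : fps R :=
  Fps (fun n => fcoef f n *+ n).

Lemma eulerD (R : comNzRingType) (f g : fps R) :
  euler (f + g) = euler f + euler g.
Proof. by apply: fpsP => n /=; rewrite mulrnDl. Qed.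

Lemma eulerN (R : comNzRingType) (f : fps R) : euler (- f) = - euler f.
Proof. by apply: fpsP => n /=; rewrite mulNrn. Qed.

Lemma euler1 (R : comNzRingType) : euler (1 : fps R) = 0.
Proof. by apply: fpsP => -[|n] //=; rewrite mul0rn. Qed.

Lemma eulerX (R : comNzRingType) : euler (fpsX R) = fpsX R.
Proof. by apply: fpsP => -[|[|n]] //=; rewrite mul0rn. Qed.

Lemma eulerM (R : comNzRingType) (f g : fps R) :
  euler (f * g) = euler f * g + f * euler g.
Proof.
apply: fpsP => n /=; rewrite -sumrMnl -big_split /=; apply: eq_bigr => i _.
by rewrite mulrnAl mulrnAr -mulrnDr subnKC // -ltnS.
Qed.

Lemma eulerXn (R : comNzRingType) (f : fps R) m :
  euler (f ^+ m.+1) = m.+1%:R * (f ^+ m * euler f).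
Proof.
elim: m => [|m IHm]; first by rewrite expr1 expr0 !mul1r.
rewrite exprS eulerM IHm [m.+2%:R]mulrSr exprS; ring.
Qed.

Lemma eulerV (R : comUnitRingType) (f : fps R) :
  f \is a GRing.unit -> euler f^-1 = - (f^-1 ^+ 2 * euler f).
Proof.
move=> Uf; have fV := mulVr Uf.
have := congr1 euler fV; rewrite eulerM euler1 => /eqP.
rewrite addr_eq0 => /eqP dfV.
by rewrite -[LHS]mulr1 -(divrr Uf) mulrA dfV; ring.
Qed.

(** * Expansion in powers of [u = x psi] *)

(** The [n]-th coefficient is the residue of [F u' / u^(n+1)], because
    [u' = psi + euler psi] and [u^(n+1) = x^(n+1) psi^(n+1)]; by Cauchy's formula
    it is the coefficient of [u^n] in [F]. *)
Definition expand_in_u {R : comUnitRingType} (psi F : fps R) : fps R :=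
  Fps (fun n => fcoef (F * (psi + euler psi) * psi^-1 ^+ n.+1) n).

Lemma fcoef_expand_in_u (R : comUnitRingType) (psi F : fps R) n :
  fcoef (expand_in_u psi F) n = fcoef (F * (psi + euler psi) * psi^-1 ^+ n.+1) n.
Proof. by []. Qed.

Lemma expand_in_u_is_zmod_morphism (R : comUnitRingType) (psi : fps R) :
  zmod_morphism (expand_in_u psi).
Proof.
move=> F G; apply: fpsP => n.
by rewrite fcoef_expand_in_u !mulrBl.
Qed.

HB.instance Definition _ (R : comUnitRingType) (psi : fps R) :=
  GRing.isZmodMorphism.Build (fps R) (fps R) (expand_in_u psi)
    (expand_in_u_is_zmod_morphism R psi).

Lemma expand_in_uC (R : comUnitRingType) (psi F : fps R) c :
  expand_in_u psi (fpsC c * F) = fpsC c * expand_in_u psi F.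
Proof.
by apply: fpsP => n; rewrite fcoef_mulC !fcoef_expand_in_u -!mulrA fcoef_mulC.
Qed.

(** The factor [psi] of [u] cancels one power of [psi^-1], and its factor [x]
    shifts the coefficient: together they replace [n.+1] by [n]. *)
Lemma expand_in_uM (R : comUnitRingType) (psi F : fps R) :
  psi \is a GRing.unit ->
  expand_in_u psi (fpsX R * psi * F) = fpsX R * expand_in_u psi F.
Proof.
move=> Upsi; apply: fpsP => -[|n].
  by rewrite fcoef_mulX0 fcoef_expand_in_u -!mulrA fcoef_mulX0.
rewrite fcoef_mulXS fcoef_expand_in_u -!mulrA fcoef_mulXS.
rewrite fcoef_expand_in_u; congr (fcoef _ n).
by rewrite exprS (mulrCA (psi + _)) !mulrA -[_ * F]mulrC -!mulrA mulVKr // !mulrA.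
Qed.

(** For [n > 0], [u' / u^(n+1)] is the derivative of [- u^(-n) / n] and so has
    no residue.  In terms of [phi = psi^-1], [n u' phi^(n+1)] equals
    [n phi^n - euler (phi^n)], whose coefficient of [x^n] is zero. *)
Lemma expand_in_u1 (F : fieldType) (psi : fps F) :
  [pchar F] =i pred0 -> psi \is a GRing.unit -> expand_in_u psi 1 = 1.
Proof.
move=> charF Upsi; apply: fpsP => n; rewrite fcoef_expand_in_u mul1r mulrDl.
rewrite exprS mulVKr // fcoefD.
case: n => [|k].
  by rewrite expr0 mulr1 /= big_ord1 mul0r addr0.
set phi := psi^-1.
have residue : k.+1%:R * (euler psi * (phi * phi ^+ k.+1)) = - euler (phi ^+ k.+1).
  by rewrite eulerXn eulerV // -/phi !exprS; ring.
have := congr1 (fun f => fcoef f k.+1) residue.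
rewrite natr_fpsC fcoef_mulC => residue_k.
have k1_neq0 : k.+1%:R != 0 :> F by rewrite (iffLR (pcharf0P F)).
apply: (mulfI k1_neq0); rewrite mulrDr residue_k mulr_natl mulr0.
exact: addrN.
Qed.

(** Because [psi] is invertible, [f = c + u f1] for a constant [c] and a series
    [f1].  By linearity and [expand_in_uM] the claim for [f] at the coefficient
    of [x^(n+1)] reduces to the claim for [f1] at that of [x^n]. *)
Lemma expand_in_u_mul (F : fieldType) (psi f g : fps F) :
  [pchar F] =i pred0 -> psi \is a GRing.unit ->
  expand_in_u psi (f * g) = expand_in_u psi f * expand_in_u psi g.
Proof.
move=> charF Upsi; apply: fpsP => n.
have split_u h : exists c h1, h = fpsC c + fpsX F * psi * h1.
  exists (fcoef h 0), (psi^-1 * fps_shift h).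
  by rewrite -[LHS]fps_shiftK -[_ * psi * _]mulrA mulVKr.
have expand_split c h1 h : expand_in_u psi ((fpsC c + fpsX F * psi * h1) * h)
    = fpsC c * expand_in_u psi h + fpsX F * expand_in_u psi (h1 * h).
  by rewrite mulrDl -(mulrA (_ * psi)) raddfD /= expand_in_uC expand_in_uM.
elim: n f => [|n IHn] f; have [c [f1 ->]] := split_u f.
all: rewrite -[X in _ = fcoef (expand_in_u psi X * _) _]mulr1 !expand_split.
all: rewrite expand_in_u1 // !mulr1 mulrDl -(mulrA (fpsX F)) !(fcoefD F).
  by rewrite !fcoef_mulX0.
by rewrite !fcoef_mulXS IHn.
Qed.

(** * The generating function *)

Definition quartic {R : comNzRingType} (t A : R) : R :=
  (256 * t ^+ 2 + 107 * t - 32) * (A ^+ 4 - A ^+ 3)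
  + (96 * t ^+ 2 + 36 * t) * A ^+ 2 - (16 * t ^+ 2 + 4 * t) * A + t ^+ 2.

Lemma rmorph_quartic (R S : comNzRingType) (T : {rmorphism R -> S}) (t A : R) :
  T (quartic t A) = quartic (T t) (T A).
Proof.
by rewrite /quartic !(rmorph_nat, rmorphXn, rmorphN, rmorphM, rmorphD).
Qed.

(** The curve cut out by [quartic] is rational.  Here [G] is [psi / u'] after
    cancelling the common factor [1 - x] of [psi] and [u']. *)
Lemma quartic_param (R : comUnitRingType) (x G : R) :
  1 - x - 4 * x ^+ 2 \is a GRing.unit ->
  G * (1 - x - 4 * x ^+ 2) = 1 - x ^+ 2 ->
  quartic (x * ((1 - x) * (1 - x ^+ 2))) G = 0.
Proof.
set e := 1 - x - 4 * x ^+ 2; set u := x * _ => Ue Ge.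
apply: (mulIr (unitrX 4 Ue)); rewrite mul0r /quartic.
(* Spread [e ^+ 4] over the terms so that [G] occurs only in [G * e], which is
   a polynomial in [x]. *)
transitivity ((256 * u ^+ 2 + 107 * u - 32) * ((G * e) ^+ 4 - (G * e) ^+ 3 * e)
  + (96 * u ^+ 2 + 36 * u) * (G * e) ^+ 2 * e ^+ 2
  - (16 * u ^+ 2 + 4 * u) * (G * e) * e ^+ 3 + u ^+ 2 * e ^+ 4); first by ring.
by rewrite Ge /e /u; ring.
Qed.

Theorem lemma2 :
  let t : fps rat := fpsX rat in
  let A : fps rat := Fps a348410 in
  (256 * t ^+ 2 + 107 * t - 32) * (A ^+ 4 - A ^+ 3)
  + (96 * t ^+ 2 + 36 * t) * A ^+ 2 - (16 * t ^+ 2 + 4 * t) * A + t ^+ 2 = 0.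
Proof.
move=> t A.
set psi : fps rat := (1 - t) * (1 - t ^+ 2).
set e : fps rat := 1 - t - 4 * t ^+ 2.
have charQ : [pchar rat] =i pred0 by apply: Num.Theory.pchar_num.
have Upsi : psi \is a GRing.unit.
  by rewrite unit_fpsE /psi expr2 fcoefM0 !fcoefD !fcoefN fcoefM0.
have Ue : e \is a GRing.unit.
  by rewrite unit_fpsE /e expr2 !fcoefD !fcoefN !fcoefM0 !mulr0.
have derivative_u : psi + euler psi = (1 - t) * e.
  have euler_t : euler t = t by apply: eulerX.
  by rewrite /psi /e !(eulerM, eulerD, eulerN, euler1, euler_t, expr2); ring.
have T1 := expand_in_u1 _ _ charQ Upsi.
have TM f g := expand_in_u_mul _ _ f g charQ Upsi.
pose T : {rmorphism fps rat -> fps rat} :=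
  HB.pack (expand_in_u psi)
    (GRing.isMonoidMorphism.Build _ _ (expand_in_u psi) (T1, TM)).
have Tu : T (t * psi) = t.
  by rewrite -[t * psi]mulr1 [LHS]expand_in_uM // T1 mulr1.
have TG : T ((1 - t ^+ 2) / e) = A.
  apply: fpsP => n; rewrite [LHS]fcoef_expand_in_u derivative_u.
  rewrite mulrCA divrK // -/psi exprS mulVKr //.
  by rewrite exprVn.
have := congr1 T (quartic_param _ t ((1 - t ^+ 2) / e) Ue (divrK Ue _)).
by rewrite rmorph_quartic Tu TG rmorph0.
Qed.
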